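(* Let $\Sigma$ be a generic discrete projective minimal surface (i.e. $\Delta_2T=0$, $\Delta_1\bar T=0$, and $T\neq0$, $\bar T\neq0$ everywhere) with associated lattice of Lie quadrics $\{Q\}$. Then $\{Q\}$ admits a two-parameter family of envelopes. An envelope is uniquely determined by (generically) prescribing a vertex on one lattice Lie quadric: for a generic point $\omega^0$ of one quadric of the lattice, say $Q(0,0)$, there exists exactly one envelope $\Omega$ of $\{Q\}$ with $\omega(0,0)=\omega^0$.
   Context: For a function $h$ on $\mathbb{Z}^2$, $h_1(n_1,n_2)=h(n_1+1,n_2)$, $h_2(n_1,n_2)=h(n_1,n_2+1)$, $h_{\bar1},h_{\bar2}$ are the inverse shifts and $\Delta_ih=h_i-h$. Bars on letters such as $\bar a$ merely distinguish functions. A discrete asymptotic net is a map $\mathbb{Z}^2\to\mathbb{P}^3$ with homogeneous coordinates $r:\mathbb{Z}^2\to\mathbb{R}^4$ such that the star $r,r_1,r_2,r_{\bar1},r_{\bar2}$ is always coplanar; the quadrilaterals $[r,r_1,r_2,r_{12}]$ of $\Sigma$ are assumed non-planar. A quadric is associated with a quadrilateral if it contains its four extended edges. A lattice of Lie quadrics is a choice of one associated quadric per quadrilateral such that the tangent planes of any two neighbouring quadrics coincide along the common edge. Adapted canonical frame: homogeneous coordinates $r$ and nowhere vanishing functions $\alpha,\bar\alpha$ with $\alpha\bar\alpha_1=\bar\alpha\alpha_2$ are chosen such that, with $r^1=\alpha r_1$, $r^2=\bar\alpha r_2$, $r^{12}=\alpha\bar\alpha_1r_{12}$, the quadrics of the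 lattice are $Q=r^{12}+\mu r^1+\nu r^2+\mu\nu r$ ($\mu,\nu$ parametrising the generators) and $$r_1=\tfrac1\alpha r^1,\quad r^1_1=-\alpha r+u r^1+b r^{12},\quad r^2_1=\tfrac1\alpha r^{12},\quad r^{12}_1=a r^1-\alpha r^2+v r^{12},$$ $$r_2=\tfrac1{\bar\alpha} r^2,\quad r^1_2=\tfrac1{\bar\alpha} r^{12},\quad r^2_2=-\bar\alpha r+\bar u r^2+\bar b r^{12},\quad r^{12}_2=-\bar\alpha r^1+\bar a r^2+\bar v r^{12}$$ (here $r^1_1=(r^1)_1$, etc.). Put $g=(u-v)/2$, $\bar g=(\bar u-\bar v)/2$, $T=ab+g^2$, $\bar T=\bar a\bar b+\bar g^2$. The functions $a,b,\bar a,\bar b$ are assumed nowhere vanishing. The net $\Sigma$ is a discrete projective minimal surface if there exists a lattice of Lie quadrics such that, in terms of its adapted canonical frame, $\Delta_2T=0$ or, equivalently, $\Delta_1\bar T=0$; this lattice is ''the associated lattice of Lie quadrics''. It is generic if $T\ne0$ and $\bar T\ne0$. An envelope $\Omega$ of $\{Q\}$ is a combinatorially dual discrete asymptotic net, represented by $\omega:\mathbb{Z}^2\to\mathbb{R}^4$ with one vertex $\omega(n_1,n_2)$ on each quadric $Q(n_1,n_2)$, such that the star of $\Omega$ centred at any vertex $\omega$ touches the corresponding quadric $Q$ at $\omega$, i.e. $\omega_1,\omega_2,\omega_{\bar1},\omega_{\bar2}$ lie in the tangent plane of $Q$ at $\omega$. Vertices of envelopes are assumed not to lie on the edges of the quadrilaterals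 of $\Sigma$, that is $\omega=r^{12}+\mu r^1+\nu r^2+\mu\nu r$ with $\mu,\nu$ finite and non-zero functions on $\mathbb{Z}^2$. ''Generic point of $Q(0,0)$'' means a point outside a countable union of generators of $Q(0,0)$. *)

(* Defs.v *)
From HB Require Import structures.
From mathcomp Require Import all_boot all_order all_algebra.
From mathcomp Require Import boolp classical_sets functions cardinality reals.

Set Implicit Arguments.
Unset Strict Implicit.
Unset Printing Implicit Defensive.

Import Order.TTheory GRing.Theory Num.Theory.

Local Open Scope ring_scope.

(* Functions on Z^2; [sh1 h], [sh2 h], [shb1 h], [shb2 h] are the shifted
   functions h_1, h_2, h_{\bar 1}, h_{\bar 2}. *)
Definition lattice (T : Type) := int -> int -> T.

Definition sh1 T (h : lattice T) : lattice T := fun n1 n2 => h (n1 + 1) n2.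
Definition sh2 T (h : lattice T) : lattice T := fun n1 n2 => h n1 (n2 + 1).
Definition shb1 T (h : lattice T) : lattice T := fun n1 n2 => h (n1 - 1) n2.
Definition shb2 T (h : lattice T) : lattice T := fun n1 n2 => h n1 (n2 - 1).

Definition diff1 (V : zmodType) (h : lattice V) : lattice V :=
  fun n1 n2 => sh1 h n1 n2 - h n1 n2.
Definition diff2 (V : zmodType) (h : lattice V) : lattice V :=
  fun n1 n2 => sh2 h n1 n2 - h n1 n2.

(* Maps Z^2 -> P^3 are given by homogeneous coordinates: nowhere vanishing row
   vectors of R^4.  Two vectors represent the same point when they have the
   same row space, [(x == y)%MS]; lines and planes are likewise row spaces. *)
Definition net (R : realType) := lattice 'rV[R]_4.

Definition same_net (R : realType) (x y : net R) : Prop :=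
  forall n1 n2, (x n1 n2 == y n1 n2)%MS.

Definition discrete_asymptotic_net (R : realType) (x : net R) : Prop :=
  (forall n1 n2, x n1 n2 != 0) /\
  (forall n1 n2, (\rank (x n1 n2 + sh1 x n1 n2 + sh2 x n1 n2
                         + shb1 x n1 n2 + shb2 x n1 n2)%MS <= 3)%N).

Definition nonplanar_quadrilaterals (R : realType) (x : net R) : Prop :=
  forall n1 n2,
    \rank (x n1 n2 + sh1 x n1 n2 + sh2 x n1 n2 + sh1 (sh2 x) n1 n2)%MS = 4%N.

(* A quadric is given by its Gram matrix.  Nondegeneracy ensures that there is
   a tangent plane at each of its points. *)
Definition is_quadric (R : realType) (A : 'M[R]_4) : Prop :=
  A^T = A /\ A \in unitmx.

Definition on_quadric (R : realType) (A : 'M[R]_4) (p : 'rV[R]_4) : Prop :=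
  p *m A *m p^T = 0.

Definition contained_in_quadric (R : realType) (m : nat)
    (A : 'M[R]_4) (L : 'M[R]_(m, 4)) : Prop :=
  forall p : 'rV[R]_4, (p <= L)%MS -> on_quadric A p.

Definition generator (R : realType) (A : 'M[R]_4) (L : 'M[R]_(2, 4)) : Prop :=
  row_free L /\ contained_in_quadric A L.

(* The row space is {y | y A p^T = 0}. *)
Definition tangent_plane (R : realType) (A : 'M[R]_4) (p : 'rV[R]_4)
    : 'M[R]_4 := kermx (A *m p^T).

Definition associated_quadric (R : realType) (x x1 x2 x12 : 'rV[R]_4)
    (A : 'M[R]_4) : Prop :=
  is_quadric A /\
  [/\ contained_in_quadric A (x + x1)%MS,
      contained_in_quadric A (x + x2)%MS,
      contained_in_quadric A (x1 + x12)%MS &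
      contained_in_quadric A (x2 + x12)%MS].

Definition tangent_along (R : realType) (A B L : 'M[R]_4) : Prop :=
  forall p : 'rV[R]_4, (p <= L)%MS ->
    (tangent_plane A p == tangent_plane B p)%MS.

(* [Q n1 n2] belongs to the quadrilateral [x, x_1, x_2, x_12] at (n1, n2); it
   shares the edge [x_1, x_12] with Q_1 and the edge [x_2, x_12] with Q_2. *)
Definition lattice_of_Lie_quadrics (R : realType) (x : net R)
    (Q : lattice 'M[R]_4) : Prop :=
  [/\ forall n1 n2, associated_quadric (x n1 n2) (sh1 x n1 n2) (sh2 x n1 n2)
                      (sh1 (sh2 x) n1 n2) (Q n1 n2),
      forall n1 n2, tangent_along (Q n1 n2) (sh1 Q n1 n2)
                      (sh1 x n1 n2 + sh1 (sh2 x) n1 n2)%MS &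
      forall n1 n2, tangent_along (Q n1 n2) (sh2 Q n1 n2)
                      (sh2 x n1 n2 + sh1 (sh2 x) n1 n2)%MS].

(* A suffix [b] stands for a bar: [fa] is a and [fab] is \bar a. *)
Record frame (R : realType) := Frame {
  fr : net R;
  fal : lattice R; falb : lattice R;
  fa : lattice R; fb : lattice R; fu : lattice R; fv : lattice R;
  fab : lattice R; fbb : lattice R; fub : lattice R; fvb : lattice R
}.

(* r^1, r^2 and r^12 *)
Definition fr1 (R : realType) (F : frame R) : net R :=
  fun n1 n2 => fal F n1 n2 *: sh1 (fr F) n1 n2.
Definition fr2 (R : realType) (F : frame R) : net R :=
  fun n1 n2 => falb F n1 n2 *: sh2 (fr F) n1 n2.
Definition fr12 (R : realType) (F : frame R) : net R :=
  fun n1 n2 => (fal F n1 n2 * sh1 (falb F) n1 n2) *: sh1 (sh2 (fr F)) n1 n2.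

Definition quadric_point (R : realType) (F : frame R) (n1 n2 : int)
    (mu nu : R) : 'rV[R]_4 :=
  fr12 F n1 n2 + mu *: fr1 F n1 n2 + nu *: fr2 F n1 n2
  + (mu * nu) *: fr F n1 n2.

(* All points of Q, including those with mu or nu infinite: mu = m1 / m0 and
   nu = k1 / k0 are homogeneous parameters. *)
Definition parametrises (R : realType) (F : frame R) (Q : lattice 'M[R]_4)
    : Prop :=
  forall n1 n2 (p : 'rV[R]_4), on_quadric (Q n1 n2) p <->
    exists m0 m1 k0 k1 : R,
      p = (m0 * k0) *: fr12 F n1 n2 + (m1 * k0) *: fr1 F n1 n2
          + (m0 * k1) *: fr2 F n1 n2 + (m1 * k1) *: fr F n1 n2.

Definition frame_equations1 (R : realType) (F : frame R) : Prop :=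
  forall n1 n2,
  [/\ sh1 (fr F) n1 n2 = (fal F n1 n2)^-1 *: fr1 F n1 n2,
      sh1 (fr1 F) n1 n2 = - fal F n1 n2 *: fr F n1 n2
        + fu F n1 n2 *: fr1 F n1 n2 + fb F n1 n2 *: fr12 F n1 n2,
      sh1 (fr2 F) n1 n2 = (fal F n1 n2)^-1 *: fr12 F n1 n2 &
      sh1 (fr12 F) n1 n2 = fa F n1 n2 *: fr1 F n1 n2
        - fal F n1 n2 *: fr2 F n1 n2 + fv F n1 n2 *: fr12 F n1 n2].

Definition frame_equations2 (R : realType) (F : frame R) : Prop :=
  forall n1 n2,
  [/\ sh2 (fr F) n1 n2 = (falb F n1 n2)^-1 *: fr2 F n1 n2,
      sh2 (fr1 F) n1 n2 = (falb F n1 n2)^-1 *: fr12 F n1 n2,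
      sh2 (fr2 F) n1 n2 = - falb F n1 n2 *: fr F n1 n2
        + fub F n1 n2 *: fr2 F n1 n2 + fbb F n1 n2 *: fr12 F n1 n2 &
      sh2 (fr12 F) n1 n2 = - falb F n1 n2 *: fr1 F n1 n2
        + fab F n1 n2 *: fr2 F n1 n2 + fvb F n1 n2 *: fr12 F n1 n2].

Definition adapted_canonical_frame (R : realType) (x : net R)
    (Q : lattice 'M[R]_4) (F : frame R) : Prop :=
  [/\ same_net (fr F) x,
      forall n1 n2, fal F n1 n2 != 0 /\ falb F n1 n2 != 0,
      forall n1 n2, fal F n1 n2 * sh1 (falb F) n1 n2
                    = falb F n1 n2 * sh2 (fal F) n1 n2,
      parametrises F Q &
      frame_equations1 F /\ frame_equations2 F].

Definition nonvanishing_coefficients (R : realType) (F : frame R) : Prop :=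
  forall n1 n2, [/\ fa F n1 n2 != 0, fb F n1 n2 != 0,
                    fab F n1 n2 != 0 & fbb F n1 n2 != 0].

Definition fg (R : realType) (F : frame R) : lattice R :=
  fun n1 n2 => (fu F n1 n2 - fv F n1 n2) / 2.
Definition fgb (R : realType) (F : frame R) : lattice R :=
  fun n1 n2 => (fub F n1 n2 - fvb F n1 n2) / 2.
Definition fT (R : realType) (F : frame R) : lattice R :=
  fun n1 n2 => fa F n1 n2 * fb F n1 n2 + fg F n1 n2 ^+ 2.
Definition fTb (R : realType) (F : frame R) : lattice R :=
  fun n1 n2 => fab F n1 n2 * fbb F n1 n2 + fgb F n1 n2 ^+ 2.

Definition projective_minimal (R : realType) (F : frame R) : Prop :=
  (forall n1 n2, diff2 (fT F) n1 n2 = 0) /\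
  (forall n1 n2, diff1 (fTb F) n1 n2 = 0).

Definition generic (R : realType) (F : frame R) : Prop :=
  forall n1 n2, fT F n1 n2 != 0 /\ fTb F n1 n2 != 0.

(* [x] is a generic discrete projective minimal surface, [Q] is its associated
   lattice of Lie quadrics and [F] an adapted canonical frame. *)
Definition generic_projective_minimal_surface (R : realType) (x : net R)
    (Q : lattice 'M[R]_4) (F : frame R) : Prop :=
  [/\ discrete_asymptotic_net x /\ nonplanar_quadrilaterals x,
      lattice_of_Lie_quadrics x Q,
      adapted_canonical_frame x Q F,
      nonvanishing_coefficients F &
      projective_minimal F /\ generic F].

(* The last clause says that no vertex lies on an extended edge of the
   corresponding quadrilateral. *)
Definition envelope (R : realType) (Q : lattice 'M[R]_4) (F : frame R)
    (w : net R) : Prop :=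
  [/\ discrete_asymptotic_net w,
      forall n1 n2, on_quadric (Q n1 n2) (w n1 n2),
      forall n1 n2, let P := tangent_plane (Q n1 n2) (w n1 n2) in
        [/\ (sh1 w n1 n2 <= P)%MS, (sh2 w n1 n2 <= P)%MS,
            (shb1 w n1 n2 <= P)%MS & (shb2 w n1 n2 <= P)%MS] &
      forall n1 n2, exists mu nu : R,
        [/\ mu != 0, nu != 0 & (w n1 n2 == quadric_point F n1 n2 mu nu)%MS]].

(* The parameters are those of the vertex on Q(m1, m2), restricted to the
   complement of two countable sets of exceptional values. *)
Definition two_parameter_family_of_envelopes (R : realType)
    (Q : lattice 'M[R]_4) (F : frame R) (m1 m2 : int) : Prop :=
  exists M N : set R, [/\ countable M, countable N &
    exists W : R -> R -> net R,
      (forall mu nu, ~ M mu -> ~ N nu ->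
         envelope Q F (W mu nu) /\
         (W mu nu m1 m2 == quadric_point F m1 m2 mu nu)%MS) /\
      (forall mu nu mu' nu', ~ M mu -> ~ N nu -> ~ M mu' -> ~ N nu' ->
         same_net (W mu nu) (W mu' nu') -> mu = mu' /\ nu = nu')].

Definition holds_at_generic_point (R : realType) (A : 'M[R]_4)
    (P : 'rV[R]_4 -> Prop) : Prop :=
  exists G : nat -> 'M[R]_(2, 4),
    (forall k, generator A (G k)) /\
    (forall p : 'rV[R]_4, p != 0 -> on_quadric A p ->
       (forall k, ~~ (p <= G k)%MS) -> P p).

Definition unique_envelope_through (R : realType) (Q : lattice 'M[R]_4)
    (F : frame R) (m1 m2 : int) (p : 'rV[R]_4) : Prop :=
  exists w : net R,
    [/\ envelope Q F w, (w m1 m2 == p)%MS &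
        forall w' : net R, envelope Q F w' -> (w' m1 m2 == p)%MS ->
          same_net w' w].

(* Main.v *)
Require Import Defs.
From mathcomp Require Import all_boot all_order all_algebra ring.
From mathcomp Require Import boolp classical_sets functions cardinality reals.

(** In the frame basis the quadric Q is x0 x12 = x1 x2, and its point with
    parameters (mu, nu) is (mu nu, mu, nu, 1).  For two neighbouring quadrics
    in direction 1, each of two points lies in the tangent plane at the other
    one exactly when two bilinear equations hold.  Half the difference and half
    the sum of these equations are, with w = (u + v) / 2,
      a + g (mu + mu_1) - b mu mu_1 = 0  and
      (mu - mu_1) (alpha^2 + alpha w nu + nu nu_1) = 0
    ([edge1_tangency]).  The first one says that mu_1 is the image of mu under
    the Moebius involution with matrix M = [[g, a], [b, -g]], of determinant
    -T; off the fixed points of M the second one makes nu_1 a Moebius function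
    of nu.  Exchanging the two lattice directions exchanges mu and nu.  So away
    from fixed points mu and nu evolve separately, each by one Moebius map per
    edge of Z^2.

    For mu these maps are M in direction 1 and, in direction 2,
    N = [[-wbar, -alphabar], [1 / alphabar, 0]].  The compatibility of the two
    frame equations gives three of the four entries of M_2 N = N_1 M; both N
    have determinant 1, so the fourth entry holds because Delta_2 T = 0
    ([moebius_flat]).  This flat connection on Z^2 has a fundamental solution
    ([flat_section]), so mu at an arbitrary lattice point is a fixed invertible
    Moebius function of mu at the base point.  Its value there is zero,
    infinite or a fixed point of M only for finitely many initial values, as T
    does not vanish; altogether countably many initial values are excluded
    ([moebius_sections]).  For all the others an envelope exists, and the edge
    equations propagate its parameters uniquely in all directions
    ([edge_solution_unique]).  An excluded value of mu or nu, infinity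
    included, corresponds to one generator of the quadric at the base point. *)

Set Implicit Arguments.
Unset Strict Implicit.
Unset Printing Implicit Defensive.

Import Order.TTheory GRing.Theory Num.Theory.

Local Open Scope ring_scope.

(** * Flat connections on the square lattice *)

Lemma int_shift_ind (m : int) (P : int -> Prop) :
  P m -> (forall i, P i <-> P (i + 1)) -> forall i, P i.
Proof.
move=> Pm PS i; rewrite -(subrK m i) addrC; move: (i - m) => k.
elim: k => [|n IHn|n IHn]; first by rewrite addr0.
  by rewrite -addn1 PoszD addrA; apply: (iffLR (PS _)).
apply: (iffRL (PS _)); suff -> : m - n.+1%:Z + 1 = m - n%:Z by [].
by rewrite -addn1 PoszD opprD addrA addrNK.
Qed.

(** A one-dimensional connection is always flat: the solution is the ordered
    product of the factors to the right of m, and of their inverses to its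
    left. *)
Lemma int_primitive (G : unitRingType) (f : int -> G) (m : int) :
  (forall i, f i \is a GRing.unit) ->
  exists p : int -> G, [/\ p m = 1, forall i, p i \is a GRing.unit &
    forall i, p (i + 1) = f i * p i].
Proof.
move=> fU.
pose fix up (n : nat) : G := if n is n'.+1 then f n'%:Z * up n' else 1.
pose fix down (n : nat) : G :=
  if n is n'.+1 then (f (- n%:Z))^-1 * down n' else 1.
pose q (i : int) : G :=
  match i with Posz n => up n | Negz n => down n.+1 end.
have upU n : up n \is a GRing.unit.
  by elim: n => [|n IHn] /=; rewrite ?unitr1 // unitrMl.
have downU n : down n \is a GRing.unit.
  by elim: n => [|n IHn] /=; rewrite ?unitr1 // unitrMl // unitrV.
have qU i : q i \is a GRing.unit by case: i => n; [apply: upU|apply: downU].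
have qS i : q (i + 1) = f i * q i.
  case: i => n; first by rewrite -PoszD addn1.
  rewrite NegzE [q (- _)]/= mulVKr //.
  have -> : - n.+1%:Z + 1 = - n%:Z.
    by rewrite -addn1 PoszD opprD addrNK.
  by case: n.
exists (fun i => q i / q m); split=> [|i|i]; first exact: divrr.
  by rewrite unitrMl // unitrV.
by rewrite qS mulrA.
Qed.

(** Integrate along the row through the base point, then along each column; the
    flatness condition carries the row equation from one row to the next. *)
Lemma flat_section (G : unitRingType) (A B : lattice G) (m1 m2 : int) :
  (forall i j, A i j \is a GRing.unit) ->
  (forall i j, B i j \is a GRing.unit) ->
  (forall i j, A i (j + 1) * B i j = B (i + 1) j * A i j) ->
  exists P : lattice G, [/\ P m1 m2 = 1, forall i j, P i j \is a GRing.unit,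
    forall i j, P (i + 1) j = A i j * P i j &
    forall i j, P i (j + 1) = B i j * P i j].
Proof.
move=> AU BU flat.
have [h [hm hU hS]] := int_primitive m1 (fun i => AU i m2).
have [V HV] := choice (fun i => int_primitive m2 (BU i)).
have Vm i : V i m2 = 1 by case: (HV i).
have VU i j : V i j \is a GRing.unit by case: (HV i).
have VS i j : V i (j + 1) = B i j * V i j by case: (HV i).
exists (fun i j => V i j * h i); split=> [|i j|i j|i j].
- by rewrite Vm hm mulr1.
- by rewrite unitrMl.
- elim/(@int_shift_ind m2): j => [|j]; first by rewrite !Vm !mul1r hS.
  rewrite !VS; split=> [E|E].
    by rewrite -mulrA E mulrA -flat !mulrA.
  by apply: (mulrI (BU (i + 1) j)); rewrite mulrA E [RHS]mulrA -flat !mulrA.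
- by rewrite VS mulrA.
Qed.

(** * Discrete Moebius evolutions *)

Lemma roots_in_seq (R : idomainType) (p : {poly R}) :
  p != 0 -> exists s : seq R, forall x, root p x -> x \in s.
Proof.
elim: {p}(size p) {-2}p (leqnn (size p)) => [|n IHn] p.
  by rewrite leqn0 size_poly_eq0 => /eqP ->; rewrite eqxx.
move=> szp p0; have [[x px]|noroot] := pselect (exists x, root p x); last first.
  by exists [::] => x px; case: noroot; exists x.
have [q pE] := factor_theorem p x px.
have q0 : q != 0 by apply: contraNneq p0 => q0; rewrite pE q0 mul0r.
have [|s sP] := IHn q _ q0.
  by move: szp; rewrite pE size_Mmonic ?monicXsubC // size_XsubC addn2.
exists (x :: s) => y; rewrite pE rootM root_XsubC inE orbC.
by case/orP => [->|/sP ->] //; rewrite orbT.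
Qed.

Definition mat2 (R : pzRingType) (a b c d : R) : 'M[R]_2 :=
  \matrix_(i, j) if i == 0 then (if j == 0 then a else b)
                 else (if j == 0 then c else d).

Lemma mul_mat2 (R : pzRingType) (a b c d : R) (A : 'M[R]_2) :
  mat2 a b c d * A =
  mat2 (a * A 0 0 + b * A 1 0) (a * A 0 1 + b * A 1 1)
       (c * A 0 0 + d * A 1 0) (c * A 0 1 + d * A 1 1).
Proof.
apply/matrixP => i j; rewrite !mxE big_ord_recl big_ord1 !mxE /=.
have -> : lift 0 0 = 1 :> 'I_2 by apply/val_inj.
by case: (unliftP 0 i) => [i'|] ->; case: (unliftP 0 j) => [j'|] -> //=;
  rewrite ?[i']ord1 ?[j']ord1 //=; congr (_ * A _ _ + _ * A _ _);
  apply/val_inj.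
Qed.

Lemma mat2_unit (R : fieldType) (A : 'M[R]_2) :
  (A \is a GRing.unit) = (A 0 0 * A 1 1 - A 0 1 * A 1 0 != 0).
Proof.
have -> : (A \is a GRing.unit) = (A \in unitmx) by [].
rewrite unitmxE unitfE; congr (_ != 0).
rewrite (expand_det_row _ 0) big_ord_recl big_ord1 /cofactor !det_mx11 !mxE /=.
rewrite expr0 expr1 mul1r mulN1r mulrN.
by congr (_ * A _ _ - A _ _ * A _ _); apply/val_inj.
Qed.

(** The roots of this polynomial are the initial values at which the Moebius
    function x / y takes the value 0, infinity or a fixed point of the
    involution with matrix [[g, a], [b, -g]].  The quadratic factor does not
    vanish identically, since its discriminant is
    4 (a b + g^2) (p s - q r)^2. *)
Lemma involution_poly_neq0 (R : numFieldType) (a b g p q r s : R)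
    (x := p *: 'X + q%:P) (y := r *: 'X + s%:P) :
  a * b + g ^+ 2 != 0 -> p * s - q * r != 0 ->
  x * y * (b *: (x * x) - (2 * g) *: (x * y) - a *: (y * y)) != 0.
Proof.
move=> T0 D0.
have xE t : x.[t] = p * t + q by rewrite !hornerE.
have yE t : y.[t] = r * t + s by rewrite !hornerE.
rewrite !mulf_neq0 //.
- apply: contraNneq D0 => x0.
  have := xE 0; have := xE 1; rewrite x0 !hornerE => e1 e0.
  by move: e1; rewrite -e0 addr0 => <-; rewrite !mul0r subrr.
- apply: contraNneq D0 => y0.
  have := yE 0; have := yE 1; rewrite y0 !hornerE => e1 e0.
  by move: e1; rewrite -e0 addr0 => <-; rewrite !mulr0 subrr.
apply/eqP => z0; have zE t : b * (x.[t] * x.[t]) - 2 * g * (x.[t] * y.[t])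
    - a * (y.[t] * y.[t]) = 0.
  have := congr1 (fun h => h.[t]) z0; by rewrite !hornerE.
have := zE 0; have := zE 1; have := zE (-1).
rewrite !xE !yE => em ep e0.
have : (2 * 2 * 2 * 2) * ((a * b + g ^+ 2) * (p * s - q * r) ^+ 2) = 0.
  set A := LHS in em; set B := LHS in ep; set C := LHS in e0.
  transitivity ((B - A) ^+ 2 - 2 * 2 * 2 * (B + A - 2 * C) * C).
    by rewrite /A /B /C; ring.
  by rewrite em ep e0; ring.
by apply/eqP; rewrite !mulf_neq0 ?expf_neq0 ?pnatr_eq0.
Qed.

(** The hypothesis on the coefficients is M_2 N = N_1 M, entry by entry, for
    M = [[g, a], [b, -g]] and N = [[-w, -k], [1 / k, 0]]; in the conclusion
    X x0 is the solution of the Moebius evolution that starts at x0, and e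
    enumerates the starting values whose solution meets 0, infinity or a fixed
    point of M. *)
Lemma moebius_sections (R : numFieldType) (a b g w k : lattice R)
    (m1 m2 : int) :
  (forall i j, k i j != 0) ->
  (forall i j, a i j * b i j + g i j ^+ 2 != 0) ->
  (forall i j,
    [/\ - (g i (j + 1) * w i j) + a i (j + 1) / k i j
          = - (w (i + 1) j * g i j) - k (i + 1) j * b i j,
        g i (j + 1) * k i j = w (i + 1) j * a i j - k (i + 1) j * g i j,
        b i (j + 1) * w i j + g i (j + 1) / k i j = - (g i j / k (i + 1) j) &
        b i (j + 1) * k i j = - (a i j / k (i + 1) j)]) ->
  exists (e : nat -> R) (X : R -> lattice R),
    forall x0, (forall n, e n <> x0) ->
    X x0 m1 m2 = x0 /\ forall i j,
    [/\ X x0 i j != 0, X x0 i j != X x0 (i + 1) j,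
        a i j + g i j * (X x0 i j + X x0 (i + 1) j)
          - b i j * X x0 i j * X x0 (i + 1) j = 0 &
        k i j ^+ 2 + k i j * w i j * X x0 i j + X x0 i j * X x0 i (j + 1) = 0].
Proof.
move=> k0 T0 flat.
pose A : lattice 'M[R]_2 := fun i j => mat2 (g i j) (a i j) (b i j) (- g i j).
pose B : lattice 'M[R]_2 := fun i j => mat2 (- w i j) (- k i j) (k i j)^-1 0.
have [|i j|i j|P [Pm PU PA PB]] := @flat_section _ A B m1 m2.
- move=> i j; rewrite mat2_unit !mxE /=.
  by rewrite (_ : _ - _ = - (a i j * b i j + g i j ^+ 2)) ?oppr_eq0 //; ring.
- rewrite mat2_unit !mxE /= mulr0 sub0r mulNr opprK mulfV ?oner_eq0 //.
- rewrite !mul_mat2 !mxE /=; have [e1 e2 e3 e4] := flat i j.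
  congr mat2.
  + by rewrite mulrN e1; ring.
  + by rewrite mulrN e2; ring.
  + by rewrite mulrN mulNr -[LHS]opprK opprD !opprK e3; ring.
  + by rewrite mulrN e4; ring.
have D0 i j : P i j 0 0 * P i j 1 1 - P i j 0 1 * P i j 1 0 != 0.
  by have := PU i j; rewrite mat2_unit.
pose x i j : {poly R} := P i j 0 0 *: 'X + (P i j 0 1)%:P.
pose y i j : {poly R} := P i j 1 0 *: 'X + (P i j 1 1)%:P.
have [s sP] := choice (fun ij => roots_in_seq
  (involution_poly_neq0 (T0 ij.1 ij.2) (D0 ij.1 ij.2))).
(* The default 0 excludes nothing new, as 0 is not an admissible start. *)
pose e n := if unpickle n is Some (ij, l) then nth 0 (s ij) l else 0.
exists e, (fun x0 i j => (x i j).[x0] / (y i j).[x0]) => x0 nbad.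
have xE i j : (x i j).[x0] = P i j 0 0 * x0 + P i j 0 1 by rewrite !hornerE.
have yE i j : (y i j).[x0] = P i j 1 0 * x0 + P i j 1 1 by rewrite !hornerE.
have good i j : [/\ (x i j).[x0] != 0, (y i j).[x0] != 0 &
    b i j * ((x i j).[x0] * (x i j).[x0])
    - (2 * g i j) * ((x i j).[x0] * (y i j).[x0])
    - a i j * ((y i j).[x0] * (y i j).[x0]) != 0].
  have : ~~ (x0 \in s (i, j)).
    apply/negP => x0s; apply: (nbad (pickle ((i, j), index x0 (s (i, j))))).
    by rewrite /e pickleK nth_index.
  move=> /(contra (@sP (i, j) x0)) /=; rewrite -/(x i j) -/(y i j) !rootE.
  by rewrite !hornerE !mulf_eq0 !negb_or => /andP[/andP[-> ->] ->].
have [x1E y1E] : (forall i j, (x (i + 1) j).[x0] =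
      g i j * (x i j).[x0] + a i j * (y i j).[x0]) /\
    (forall i j, (y (i + 1) j).[x0] =
      b i j * (x i j).[x0] - g i j * (y i j).[x0]).
  by split=> i j; rewrite !xE !yE PA mul_mat2 !mxE /=;
    ring.
have [x2E y2E] : (forall i j, (x i (j + 1)).[x0] =
      - w i j * (x i j).[x0] - k i j * (y i j).[x0]) /\
    (forall i j, (y i (j + 1)).[x0] = (k i j)^-1 * (x i j).[x0]).
  by split=> i j; rewrite !(xE, yE) PB mul_mat2
    !mxE /=; ring.
split=> [|i j].
  by rewrite xE yE Pm !mxE /= mul1r mul0r addr0 add0r divr1.
have [xn0 yn0 qn0] := good i j.
have [_ yn1 _] := good (i + 1) j.
have [_ yn2 _] := good i (j + 1).
move: (k0 i j) yn1 yn2; rewrite x1E y1E x2E y2E.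
move: (x i j).[x0] (y i j).[x0] xn0 yn0 qn0 => X Y X0 Y0 q0 kn0 Y1 Y2.
split.
- by rewrite mulf_neq0 ?invr_eq0.
- rewrite -subr_eq0; apply: contraNneq q0 => E.
  rewrite (_ : _ - _ =
    (X / Y - (g i j * X + a i j * Y) / (b i j * X - g i j * Y))
    * (Y * (b i j * X - g i j * Y))); first by rewrite E mul0r.
  by field; rewrite Y0 Y1.
- by field; rewrite Y0 Y1.
- by field; rewrite Y0 kn0 X0.
Qed.

(** * Frames and Gram matrices *)

Definition transpose (T : Type) (h : lattice T) : lattice T := fun i j => h j i.

(** The same frame with the two lattice directions exchanged, so that each fact
    about direction 1 also yields one about direction 2. *)
Definition transpose_frame (R : realType) (F : frame R) : frame R :=
  Frame (transpose (fr F)) (transpose (falb F)) (transpose (fal F))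
    (transpose (fab F)) (transpose (fbb F)) (transpose (fub F))
    (transpose (fvb F)) (transpose (fa F)) (transpose (fb F))
    (transpose (fu F)) (transpose (fv F)).

(** The argument x3 is the coordinate called x12 in the equation of the
    quadric. *)
Definition comb (R : realType) (F : frame R) (i j : int) (x0 x1 x2 x3 : R)
    : 'rV[R]_4 :=
  x3 *: fr12 F i j + x1 *: fr1 F i j + x2 *: fr2 F i j + x0 *: fr F i j.

Definition bil (R : realType) (A : 'M[R]_4) (x y : 'rV[R]_4) : R :=
  (x *m A *m y^T) 0 0.

(** The part of the hypotheses that is invariant under exchange of the two
    lattice directions; [lf_gram] is the equation x0 x12 = x1 x2 in polarised
    form. *)
Record lie_frame (R : realType) (F : frame R) (Q : lattice 'M[R]_4) : Prop :=
  LieFrame {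
    lf_al : forall i j, fal F i j != 0;
    lf_alb : forall i j, falb F i j != 0;
    lf_closed : forall i j,
      fal F i j * falb F (i + 1) j = falb F i j * fal F i (j + 1);
    lf_eq1 : frame_equations1 F;
    lf_eq2 : frame_equations2 F;
    lf_free : forall i j x0 x1 x2 x3, comb F i j x0 x1 x2 x3 = 0 ->
      [/\ x0 = 0, x1 = 0, x2 = 0 & x3 = 0];
    lf_unit : forall i j, Q i j \in unitmx;
    lf_gram : forall i j, exists2 c : R, c != 0 &
      forall x0 x1 x2 x3 y0 y1 y2 y3,
        bil (Q i j) (comb F i j x0 x1 x2 x3) (comb F i j y0 y1 y2 y3)
        = c * (x0 * y3 + x3 * y0 - x1 * y2 - x2 * y1);
    lf_coef : nonvanishing_coefficients F;
    lf_minimal : projective_minimal F;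
    lf_generic : generic F }.

Section Bilinear.
Variables (R : realType) (A : 'M[R]_4).
Implicit Types x y z : 'rV[R]_4.

Lemma bilDl x y z : bil A (x + y) z = bil A x z + bil A y z.
Proof. by rewrite /bil !mulmxDl mxE. Qed.

Lemma bilDr x y z : bil A x (y + z) = bil A x y + bil A x z.
Proof. by rewrite /bil linearD mulmxDr mxE. Qed.

Lemma bilZl c x y : bil A (c *: x) y = c * bil A x y.
Proof. by rewrite /bil -!scalemxAl mxE. Qed.

Lemma bilZr c x y : bil A x (c *: y) = c * bil A x y.
Proof. by rewrite /bil linearZ -scalemxAr mxE. Qed.

Lemma bilC x y : A^T = A -> bil A x y = bil A y x.
Proof.
by move=> AT; rewrite /bil -[in LHS](trmxK (x *m A *m y^T)) mxE !trmx_mul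
  trmxK AT mulmxA.
Qed.

Lemma bil0P x y : reflect (x *m A *m y^T = 0) (bil A x y == 0).
Proof.
apply: (iffP eqP) => [E|E]; last by rewrite /bil E mxE.
by rewrite [LHS]mx11_scalar -/(bil A x y) E raddf0.
Qed.

Lemma tangent_planeE x y : (x <= tangent_plane A y)%MS = (bil A x y == 0).
Proof. by rewrite sub_kermx mulmxA; apply/eqP/bil0P. Qed.

Lemma on_quadricE x : on_quadric A x <-> bil A x x = 0.
Proof. by split=> [/bil0P/eqP|/eqP/bil0P]. Qed.

End Bilinear.

Lemma comb_transpose (R : realType) (F : frame R) i j x0 x1 x2 x3 :
  (forall i j, fal F i j * falb F (i + 1) j = falb F i j * fal F i (j + 1)) ->
  comb (transpose_frame F) j i x0 x1 x2 x3 = comb F i j x0 x2 x1 x3.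
Proof.
move=> cl; rewrite /comb.
have -> : fr12 (transpose_frame F) j i = fr12 F i j.
  by rewrite /fr12 /sh1 /sh2 /= /transpose -cl.
by congr (_ + _); rewrite -!addrA; congr (_ + _); rewrite addrC.
Qed.

Lemma lie_frame_transpose (R : realType) (F : frame R) Q :
  lie_frame F Q -> lie_frame (transpose_frame F) (transpose Q).
Proof.
case=> al alb cl e1 e2 free Qu gram coef [mi1 mi2] gen.
have r12E i j : fr12 (transpose_frame F) j i = fr12 F i j.
  by rewrite /fr12 /sh1 /sh2 /= /transpose -cl.
split=> //.
- by move=> i j; apply: alb.
- by move=> i j; apply: al.
- by move=> i j; rewrite /= /transpose -cl.
- move=> i j; have [E1 E2 E3 E4] := e2 j i; split.
  + exact: E1.
  + by rewrite r12E; exact: E3.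
  + by rewrite r12E; exact: E2.
  + by rewrite /sh1 !r12E [_ - _]addrC -scaleNr; exact: E4.
- move=> i j; have [E1 E2 E3 E4] := e1 j i; split.
  + exact: E1.
  + by rewrite r12E; exact: E3.
  + by rewrite r12E; exact: E2.
  + by rewrite /sh2 !r12E [- _ *: _ + _]addrC scaleNr; exact: E4.
- by move=> i j x0 x1 x2 x3; rewrite comb_transpose // => /free[].
- by move=> i j; apply: Qu.
- move=> i j; have [c c0 cP] := gram j i; exists c => // *.
  by rewrite !comb_transpose // cP; ring.
- by move=> i j; have [] := coef j i.
- by split=> i j; [exact: mi2 j i|exact: mi1 j i].
- by move=> i j; have [] := gen j i.
Qed.

Lemma comb_shift1 (R : realType) (F : frame R) Q i j x0 x1 x2 x3 :
  lie_frame F Q ->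
  comb F (i + 1) j x0 x1 x2 x3 =
  comb F i j (- fal F i j * x1)
    (x0 / fal F i j + fu F i j * x1 + fa F i j * x3) (- fal F i j * x3)
    (fb F i j * x1 + x2 / fal F i j + fv F i j * x3).
Proof.
move=> H; have [E1 E2 E3 E4] := lf_eq1 H i j.
rewrite /sh1 in E1 E2 E3 E4; rewrite /comb E1 E2 E3 E4.
by apply/rowP => l; rewrite !mxE; ring.
Qed.

Lemma comb_shift2 (R : realType) (F : frame R) Q i j x0 x1 x2 x3 :
  lie_frame F Q ->
  comb F i (j + 1) x0 x1 x2 x3 =
  comb F i j (- falb F i j * x2) (- falb F i j * x3)
    (x0 / falb F i j + fub F i j * x2 + fab F i j * x3)
    (fbb F i j * x2 + x1 / falb F i j + fvb F i j * x3).
Proof.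
move=> H; have cl := lf_closed H.
rewrite -[LHS]comb_transpose // -[RHS]comb_transpose //.
exact: comb_shift1 (lie_frame_transpose H).
Qed.

Lemma comb_inj (R : realType) (F : frame R) Q i j x0 x1 x2 x3 y0 y1 y2 y3 :
  lie_frame F Q -> comb F i j x0 x1 x2 x3 = comb F i j y0 y1 y2 y3 ->
  [/\ x0 = y0, x1 = y1, x2 = y2 & x3 = y3].
Proof.
move=> H E.
have /(lf_free H)[d0 d1 d2 d3] :
    comb F i j (x0 - y0) (x1 - y1) (x2 - y2) (x3 - y3) = 0.
  move/eqP: E; rewrite -subr_eq0 => /eqP <-.
  by apply/rowP => l; rewrite !mxE; ring.
by split; apply: subr0_eq.
Qed.

(** Up to the factor alpha, the coefficient of nu in the second equation of an
    edge in direction 1, and its analogue for direction 2. *)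
Definition fw (R : realType) (F : frame R) : lattice R :=
  fun i j => (fu F i j + fv F i j) / 2.
Definition fwb (R : realType) (F : frame R) : lattice R :=
  fun i j => (fub F i j + fvb F i j) / 2.

(** The two ways from the frame at (i + 1, j + 1) to the one at (i, j) agree;
    these are five of the coefficients obtained on r^1 and r^12. *)
Lemma frame_compatibility (R : realType) (F : frame R) Q i j :
  lie_frame F Q ->
  [/\ - falb F i j * fb F i (j + 1) = fa F i j / falb F (i + 1) j,
      - fal F i (j + 1) / falb F i j + fab F i j * fb F i (j + 1)
        = - fal F i j / falb F (i + 1) j,
      fu F i (j + 1) / falb F i j + fvb F i j * fb F i (j + 1)
        = fv F i j / falb F (i + 1) j,
      - falb F i j * fv F i (j + 1)
        = - falb F (i + 1) j * fu F i j + fa F i j * fvb F (i + 1) j &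
      - fal F i (j + 1) * fub F i j + fab F i j * fv F i (j + 1)
        = - fal F i j * fvb F (i + 1) j].
Proof.
move=> H.
have E x0 x1 x2 x3 : comb F (i + 1) (j + 1) x0 x1 x2 x3
  = comb F (i + 1) (j + 1) x0 x1 x2 x3 by [].
have := E 0 1 0 0; have := E 0 0 0 1; move=> {E}.
rewrite {1}(comb_shift1 _ _ _ _ _ _ H) (comb_shift2 _ _ _ _ _ _ H).
rewrite (comb_shift2 (i + 1) _ _ _ _ _ H) (comb_shift1 _ _ _ _ _ _ H).
case/(comb_inj H) => _ + + _.
rewrite {1}(comb_shift1 _ _ _ _ _ _ H) (comb_shift2 _ _ _ _ _ _ H).
rewrite (comb_shift2 (i + 1) _ _ _ _ _ H) (comb_shift1 _ _ _ _ _ _ H).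
move=> e4 e5.
case/(comb_inj H) => _ e1 e2 e3.
move: e1 e2 e3 e4 e5.
rewrite !(mul0r, mulr0, mul1r, mulr1, addr0, add0r) => -> -> -> -> e5.
by split=> //; rewrite -?e5; ring.
Qed.

Lemma fT_shift2 (R : realType) (F : frame R) Q i j :
  lie_frame F Q -> fT F i (j + 1) = fT F i j.
Proof. by move=> H; apply: subr0_eq; case: (lf_minimal H) => /(_ i j). Qed.

(** This is the identity M_2 N = N_1 M for the maps that transport mu.  The
    compatibility conditions express the coefficients at the shifted points
    through those at (i, j), which settles three entries; the fourth one then
    follows from the equality of determinants, that is from T_2 = T. *)
Lemma moebius_flat (R : realType) (F : frame R) Q i j :
  lie_frame F Q ->
  [/\ - (fg F i (j + 1) * fwb F i j) + fa F i (j + 1) / falb F i j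
        = - (fwb F (i + 1) j * fg F i j) - falb F (i + 1) j * fb F i j,
      fg F i (j + 1) * falb F i j
        = fwb F (i + 1) j * fa F i j - falb F (i + 1) j * fg F i j,
      fb F i (j + 1) * fwb F i j + fg F i (j + 1) / falb F i j
        = - (fg F i j / falb F (i + 1) j) &
      fb F i (j + 1) * falb F i j = - (fa F i j / falb F (i + 1) j)].
Proof.
move=> H; have [c1 c2 c3 c4 c5] := frame_compatibility i j H.
have [d1 _ d3 _ _] := frame_compatibility j i (lie_frame_transpose H).
move: d1 d3; rewrite /= /transpose => d1 d3.
have := fT_shift2 i j H; rewrite /fT /fg /fwb.
have cl := lf_closed H i j.
have [a0 _ _ _] := lf_coef H i j.
have al0 := lf_al H i j; have al20 := lf_al H i (j + 1).
have k0 := lf_alb H i j; have k10 := lf_alb H (i + 1) j.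
move: (fa F i j) (fb F i j) (fu F i j) (fv F i j) (fal F i j) a0 al0
  (fab F i j) (fub F i j) (fvb F i j) (falb F i j) k0
  (fal F i (j + 1)) al20 (falb F (i + 1) j) k10
  (fa F i (j + 1)) (fb F i (j + 1)) (fu F i (j + 1)) (fv F i (j + 1))
  (fbb F (i + 1) j) (fub F (i + 1) j) (fvb F (i + 1) j)
  cl c1 c2 c3 c4 c5 d1 d3.
move=> a b u v al a0 al0 ab ub vb k k0 al2 al20 k1 k10 a2 b2 u2 v2 bb1 ub1 vb1.
move=> cl c1 c2 c3 c4 c5 d1 d3 T2.
have al2E : al2 = al * k1 / k by rewrite cl; field.
have b2E : b2 = - a / (k * k1).
  by apply: (mulfI k0); rewrite -[LHS]opprK -mulNr c1; field; rewrite k0 k10.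
have abE : ab = al * (k ^+ 2 - k1 ^+ 2) / (k * a).
  have : ab * b2 = al2 / k - al / k1.
    by rewrite -[LHS](addKr (- al2 / k)) c2; ring.
  rewrite b2E al2E => E; apply: (mulIf (_ : - a / (k * k1) != 0)).
    by rewrite !mulf_neq0 ?oppr_eq0 ?invr_eq0 ?mulf_neq0.
  by rewrite E; field; rewrite a0 k0 k10.
have u2E : u2 = (k * v + a * vb) / k1.
  apply: (mulIf (_ : k^-1 != 0)); first by rewrite invr_eq0.
  by rewrite -[LHS](addrK (vb * b2)) c3 b2E; field; rewrite k0 k10.
have v2E : v2 = (k1 * u - a * vb1) / k.
  by apply: (mulfI k0); rewrite -[LHS]opprK -mulNr c4; field.
have vb1E : vb1 = k * (al * ub - ab * u) / (al * k1).
  move/eqP: c5; rewrite -subr_eq0 v2E al2E abE => /eqP c5.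
  rewrite -[LHS]subr0 -[X in _ - X](mul0r (k ^+ 2 / (k1 ^+ 2 * al))).
  by rewrite -[X in X * (_ / _)]c5; field; rewrite a0 k0 k10 al0.
have ub1E : ub1 = k * (al * vb + ab * v) / (al * k1).
  apply: (mulIf (_ : al^-1 != 0)); first by rewrite invr_eq0.
  rewrite -[LHS](addrK (v * bb1)) d3.
  have -> : bb1 = - ab / (al * al2).
    apply: (mulfI al0); rewrite -[LHS]opprK -mulNr d1.
    by field; rewrite al20 al0.
  by rewrite al2E; field; rewrite k0 k10 al0.
have f4 : b2 * k = - (a / k1) by rewrite b2E; field; rewrite k0 k10.
have f3 : b2 * ((ub + vb) / 2) + (u2 - v2) / 2 / k = - ((u - v) / 2 / k1).
  by rewrite b2E u2E v2E vb1E abE; field; rewrite a0 k0 k10 al0.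
have f2 : (u2 - v2) / 2 * k = (ub1 + vb1) / 2 * a - k1 * ((u - v) / 2).
  by rewrite u2E v2E ub1E vb1E abE; field; rewrite a0 k0 k10 al0.
split=> //.
(* The two matrices have the same determinant -T and agree in the other three
   entries; hence they agree in this one. *)
apply: (mulIf (_ : a / k1 != 0)); first by rewrite mulf_neq0 ?invr_eq0.
set w2 := (ub + vb) / 2 in f3 *; set g2 := (u2 - v2) / 2 in T2 f3 f2 *.
set w1 := (ub1 + vb1) / 2 in f2 *; set g := (u - v) / 2 in T2 f3 f2 *.
have -> : (- (g2 * w2) + a2 / k) * (a / k1)
    = - (a2 * b2 + g2 ^+ 2) + (g2 * k) * (b2 * w2 + g2 / k).
  by rewrite -[a / k1]opprK -f4; field.
by rewrite T2 f2 f3; field.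
Qed.

(** * Tangency across an edge *)

Lemma quadric_pointE (R : realType) (F : frame R) i j mu nu :
  quadric_point F i j mu nu = comb F i j (mu * nu) mu nu 1.
Proof. by rewrite /quadric_point /comb scale1r. Qed.

Lemma quadric_point_transpose (R : realType) (F : frame R) Q i j mu nu :
  lie_frame F Q ->
  quadric_point (transpose_frame F) j i nu mu = quadric_point F i j mu nu.
Proof.
move=> H; rewrite !quadric_pointE comb_transpose; last exact: lf_closed H.
by rewrite mulrC.
Qed.

(** The equations of an edge in direction 1; for direction 2 the barred
    coefficients are taken and mu and nu are exchanged. *)
Definition edge_equations (R : pzRingType) (a b g w k mu nu mu1 nu1 : R) :=
  a + g * (mu + mu1) - b * mu * mu1 = 0 /\
  (mu - mu1) * (k ^+ 2 + k * w * nu + nu * nu1) = 0.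

(** The two incidences give Y / alpha - nu X = 0 and Y / alpha + nu X = 0, where
    X and Y are the left-hand sides of the edge equations; as nu is non-zero
    they amount to X = Y = 0. *)
Lemma edge1_tangency (R : realType) (F : frame R) Q (i j : int)
    (mu nu mu1 nu1 : R) :
  lie_frame F Q -> nu != 0 ->
  (quadric_point F (i + 1)%R j mu1 nu1
     <= tangent_plane (Q i j) (quadric_point F i j mu nu))%MS /\
  (quadric_point F i j mu nu
     <= tangent_plane (Q (i + 1)%R j)
          (quadric_point F (i + 1)%R j mu1 nu1))%MS <->
  edge_equations (fa F i j) (fb F i j) (fg F i j) (fw F i j) (fal F i j)
    mu nu mu1 nu1.
Proof.
move=> H nu0; have al0 := lf_al H i j.
(* Coordinates in the frame at (i + 1, j), by inverting [comb_shift1]. *)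
have inv : quadric_point F i j mu nu = comb F (i + 1) j
    (fal F i j * mu + fa F i j * nu + fu F i j * mu * nu)
    (- (mu * nu / fal F i j))
    (fal F i j + fv F i j * nu + fb F i j * mu * nu)
    (- (nu / fal F i j)).
  rewrite quadric_pointE (comb_shift1 _ _ _ _ _ _ H).
  by congr comb; field.
rewrite !tangent_planeE {2}inv !quadric_pointE.
rewrite {1}(comb_shift1 _ _ _ _ _ _ H).
have [c c0 ->] := lf_gram H i j; have [c' c'0 ->] := lf_gram H (i + 1) j.
rewrite !mulf_eq0 (negPf c0) (negPf c'0) /= /edge_equations /fg /fw.
move: (fal F i j) (fa F i j) (fb F i j) (fu F i j) (fv F i j) al0.
move=> al a b u v al0 {inv}.
set X := a + _ - _; set Y := (mu - mu1) * _.
set e1 := (X in X == 0 /\ _); set e2 := (X in _ /\ X == 0).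
have e1E : e1 = Y / al - nu * X by rewrite /e1 /X /Y; field.
have e2E : e2 = Y / al + nu * X by rewrite /e2 /X /Y; field.
have XE : X = (e2 - e1) / (2 * nu) by rewrite e1E e2E; field; rewrite ?nu0 ?al0.
have YE : Y = (e2 + e1) * al / 2 by rewrite e1E e2E; field; rewrite ?nu0 ?al0.
clearbody X Y e1 e2; split=> [[/eqP E1 /eqP E2]|[E1 E2]].
  by rewrite XE YE E1 E2 subr0 addr0 !mul0r.
by rewrite e1E e2E E1 E2 mulr0 mul0r subr0 addr0 eqxx.
Qed.

Lemma edge2_tangency (R : realType) (F : frame R) Q (i j : int)
    (mu nu mu2 nu2 : R) :
  lie_frame F Q -> mu != 0 ->
  (quadric_point F i (j + 1)%R mu2 nu2
     <= tangent_plane (Q i j) (quadric_point F i j mu nu))%MS /\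
  (quadric_point F i j mu nu
     <= tangent_plane (Q i (j + 1)%R)
          (quadric_point F i (j + 1)%R mu2 nu2))%MS <->
  edge_equations (fab F i j) (fbb F i j) (fgb F i j) (fwb F i j) (falb F i j)
    nu mu nu2 mu2.
Proof.
move=> H mu0; rewrite -!(quadric_point_transpose _ _ _ _ H).
exact: edge1_tangency (lie_frame_transpose H) mu0.
Qed.

(** Both edge equations are affine in each unknown separately.  The two
    coefficients that have to be non-zero are g - b mu and g - b mu1, whose
    product is a b + g^2 once the first equation holds, and nu and k w + nu1,
    whose product is -k^2; the inequality mu != mu1 makes the second equation
    effective. *)
Lemma edge_solution_unique (R : fieldType) (a b g w k : R)
    (mu nu mu1 nu1 mu' nu' mu1' nu1' : R) :
  a * b + g ^+ 2 != 0 -> k != 0 -> mu != mu1 ->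
  a + g * (mu + mu1) - b * mu * mu1 = 0 ->
  k ^+ 2 + k * w * nu + nu * nu1 = 0 ->
  edge_equations a b g w k mu' nu' mu1' nu1' ->
  mu' = mu /\ nu' = nu <-> mu1' = mu1 /\ nu1' = nu1.
Proof.
move=> T0 k0 mu01 E N [E' N'].
have dmu : g - b * mu != 0.
  apply: contraNneq T0 => d; rewrite (_ : _ + _ =
    b * (a + g * (mu + mu1) - b * mu * mu1) + (g - b * mu) * (g - b * mu1));
    last by ring.
  by rewrite E d mulr0 mul0r addr0.
have dmu1 : g - b * mu1 != 0.
  apply: contraNneq T0 => d; rewrite (_ : _ + _ =
    b * (a + g * (mu + mu1) - b * mu * mu1) + (g - b * mu) * (g - b * mu1));
    last by ring.
  by rewrite E d !mulr0 addr0.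
have dnu : nu * (k * w + nu1) != 0.
  rewrite (_ : _ * _ = (k ^+ 2 + k * w * nu + nu * nu1) - k ^+ 2); last by ring.
  by rewrite N sub0r oppr_eq0 expf_neq0.
move: dnu; rewrite mulf_eq0 negb_or => /andP[nu0 dnu].
split=> -[muE nuE]; move: E' N'; rewrite muE nuE => E' N'.
- have mE : mu1' = mu1.
    apply: (mulfI dmu); apply/eqP; rewrite -subr_eq0; apply/eqP.
    by rewrite -[RHS](subrr 0) -{1}E' -{1}E; ring.
  split=> //; move/eqP: N'.
  rewrite mE mulf_eq0 subr_eq0 (negPf mu01) /= => /eqP N'.
  apply: (mulfI nu0); apply/eqP; rewrite -subr_eq0; apply/eqP.
  by rewrite -[RHS](subrr 0) -{1}N' -{1}N; ring.
- have mE : mu' = mu.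
    apply: (mulfI dmu1); apply/eqP; rewrite -subr_eq0; apply/eqP.
    by rewrite -[RHS](subrr 0) -{1}E' -{1}E; ring.
  split=> //; move/eqP: N'.
  rewrite mE mulf_eq0 subr_eq0 (negPf mu01) /= => /eqP N'.
  apply: (mulfI dnu); apply/eqP; rewrite -subr_eq0; apply/eqP.
  by rewrite -[RHS](subrr 0) -{1}N' -{1}N; ring.
Qed.

Definition envelope_equations (R : realType) (F : frame R)
    (mu nu : lattice R) :=
  forall i j,
  edge_equations (fa F i j) (fb F i j) (fg F i j) (fw F i j) (fal F i j)
    (mu i j) (nu i j) (mu (i + 1) j) (nu (i + 1) j) /\
  edge_equations (fab F i j) (fbb F i j) (fgb F i j) (fwb F i j) (falb F i j)
    (nu i j) (mu i j) (nu i (j + 1)) (mu i (j + 1)).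

Lemma tangent_plane_eqmx (R : realType) (A : 'M[R]_4) (p p' q q' : 'rV[R]_4) :
  (p == p')%MS -> (q == q')%MS ->
  (p <= tangent_plane A q)%MS = (p' <= tangent_plane A q')%MS.
Proof.
move=> /eqmxP pE /andP[/sub_rVP[c qE] /sub_rVP[d q'E]].
rewrite pE !tangent_planeE; apply/eqP/eqP => E.
  by rewrite q'E bilZr E mulr0.
by rewrite qE bilZr E mulr0.
Qed.

Lemma rank_tangent_plane (R : realType) (A : 'M[R]_4) (p : 'rV[R]_4) :
  A \in unitmx -> p != 0 -> (\rank (tangent_plane A p) <= 3)%N.
Proof.
move=> AU p0; rewrite mxrank_ker leq_subLR (leq_add2r 3 1).
rewrite lt0n mxrank_eq0; apply: contraNneq p0 => E.
by rewrite -trmx_eq0 -(mulKmx AU p^T) E mulmx0.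
Qed.

(** * Envelopes as solutions of the edge equations *)

Lemma quadric_point_on_quadric (R : realType) (F : frame R) Q i j mu nu :
  lie_frame F Q -> on_quadric (Q i j) (quadric_point F i j mu nu).
Proof.
move=> H; apply/on_quadricE; rewrite quadric_pointE.
by have [c c0 ->] := lf_gram H i j; ring.
Qed.

Lemma quadric_point_inj (R : realType) (F : frame R) Q i j mu nu mu' nu' :
  lie_frame F Q ->
  (quadric_point F i j mu nu == quadric_point F i j mu' nu')%MS ->
  mu = mu' /\ nu = nu'.
Proof.
move=> H /andP[/sub_rVP[c E] _]; move: E; rewrite !quadric_pointE.
have -> : c *: comb F i j (mu' * nu') mu' nu' 1
    = comb F i j (c * (mu' * nu')) (c * mu') (c * nu') c.
  by apply/rowP => l; rewrite !mxE; ring.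
by case/(comb_inj H) => _ -> -> <-; rewrite !mul1r.
Qed.

Lemma quadric_point_neq0 (R : realType) (F : frame R) Q i j mu nu :
  lie_frame F Q -> quadric_point F i j mu nu != 0.
Proof.
move=> H; rewrite quadric_pointE; apply/eqP => /(lf_free H)[_ _ _ /eqP].
by rewrite oner_eq0.
Qed.

Lemma envelopeP (R : realType) (F : frame R) Q (w : net R) (mu nu : lattice R) :
  lie_frame F Q -> (forall i j, mu i j != 0) -> (forall i j, nu i j != 0) ->
  (forall i j, (w i j == quadric_point F i j (mu i j) (nu i j))%MS) ->
  envelope Q F w <-> envelope_equations F mu nu.
Proof.
move=> H mu0 nu0 wE; split=> [[_ _ tan _] i j|eqs].
  split.
    apply/(edge1_tangency i j _ _ _ H (nu0 i j)).
    have [t1 _ _ _] := tan i j; have [_ _ t1' _] := tan (i + 1) j.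
    by move: t1 t1'; rewrite /sh1 /shb1 addrK
      !(tangent_plane_eqmx _ (wE _ _) (wE _ _)).
  apply/(edge2_tangency i j _ _ _ H (mu0 i j)).
  have [_ t2 _ _] := tan i j; have [_ _ _ t2'] := tan i (j + 1).
  by move: t2 t2'; rewrite /sh2 /shb2 addrK
      !(tangent_plane_eqmx _ (wE _ _) (wE _ _)).
have w0 i j : w i j != 0.
  have /andP[_ /sub_rVP[c E]] := wE i j.
  have := quadric_point_neq0 i j (mu i j) (nu i j) H.
  by apply: contraNneq => w0; rewrite E w0 scaler0.
have ww i j : (w i j <= tangent_plane (Q i j) (w i j))%MS.
  rewrite (tangent_plane_eqmx _ (wE _ _) (wE _ _)) tangent_planeE.
  by apply/eqP/on_quadricE; exact: quadric_point_on_quadric.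
have tan i j : let P := tangent_plane (Q i j) (w i j) in
    [/\ (sh1 w i j <= P)%MS, (sh2 w i j <= P)%MS,
        (shb1 w i j <= P)%MS & (shb2 w i j <= P)%MS].
  rewrite /= /sh1 /sh2 /shb1 /shb2.
  rewrite !(tangent_plane_eqmx _ (wE _ _) (wE _ _)).
  have [/(edge1_tangency i j _ _ _ H (nu0 i j))[-> _]
        /(edge2_tangency i j _ _ _ H (mu0 i j))[-> _]] := eqs i j.
  have [/(edge1_tangency _ _ _ _ _ H (nu0 _ j))[_ t1] _] := eqs (i - 1) j.
  have [_ /(edge2_tangency _ _ _ _ _ H (mu0 i _))[_ t2]] := eqs i (j - 1).
  by move: t1 t2; rewrite !subrK => -> ->.
split=> //.
- split=> // i j.
  apply: leq_trans (rank_tangent_plane (lf_unit H i j) (w0 i j)).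
  apply: mxrankS; have [t1 t2 t3 t4] := tan i j.
  by rewrite !addsmx_sub ww t1 t2 t3 t4.
- by move=> i j; apply/on_quadricE/eqP; rewrite -tangent_planeE ww.
- by move=> i j; exists (mu i j), (nu i j); split.
Qed.

Lemma regular_solution (R : realType) (F : frame R) Q (m1 m2 : int) :
  lie_frame F Q ->
  exists (e : nat -> R) (X : R -> lattice R),
    forall x0, (forall n, e n <> x0) ->
    X x0 m1 m2 = x0 /\ forall i j,
    [/\ X x0 i j != 0, X x0 i j != X x0 (i + 1) j,
        fa F i j + fg F i j * (X x0 i j + X x0 (i + 1) j)
          - fb F i j * X x0 i j * X x0 (i + 1) j = 0 &
        falb F i j ^+ 2 + falb F i j * fwb F i j * X x0 i j
          + X x0 i j * X x0 i (j + 1) = 0].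
Proof.
move=> H; apply: moebius_sections.
- exact: lf_alb H.
- by move=> i j; case: (lf_generic H i j).
- by move=> i j; exact: moebius_flat H.
Qed.

(** The parameters of an envelope solve the edge equations, and so does the
    pair of Moebius evolutions from (mu0, nu0); the latter avoids fixed points,
    so that agreement of the two solutions passes from a lattice point to each
    of its neighbours, forwards and backwards. *)
Lemma unique_envelopes (R : realType) (F : frame R) Q (m1 m2 : int) :
  lie_frame F Q ->
  exists (e f : nat -> R) (W : R -> R -> net R),
    forall mu0 nu0, (forall n, e n <> mu0) -> (forall n, f n <> nu0) ->
    [/\ envelope Q F (W mu0 nu0),
        W mu0 nu0 m1 m2 = quadric_point F m1 m2 mu0 nu0 &
        forall w, envelope Q F w ->
          (w m1 m2 == quadric_point F m1 m2 mu0 nu0)%MS ->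
          same_net w (W mu0 nu0)].
Proof.
move=> H; have [e [X XP]] := regular_solution m1 m2 H.
have [f [Y YP]] := regular_solution m2 m1 (lie_frame_transpose H).
exists e, f, (fun mu0 nu0 i j => quadric_point F i j (X mu0 i j) (Y nu0 j i)).
move=> mu0 nu0 /XP[Xm {}XP] /YP[Ym {}YP]; split; last 2 first.
- by rewrite Xm Ym.
- move=> w wenv wm; have [_ _ _ wpar] := wenv.
  have /choice[mn mnP] : forall ij : int * int, exists mn : R * R,
      [/\ mn.1 != 0, mn.2 != 0 &
        (w ij.1 ij.2 == quadric_point F ij.1 ij.2 mn.1 mn.2)%MS].
    by move=> [i j]; have [mu [nu []]] := wpar i j; exists (mu, nu).
  pose mu : lattice R := fun i j => (mn (i, j)).1.
  pose nu : lattice R := fun i j => (mn (i, j)).2.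
  have mu0' i j : mu i j != 0 by case: (mnP (i, j)).
  have nu0' i j : nu i j != 0 by case: (mnP (i, j)).
  have wE i j : (w i j == quadric_point F i j (mu i j) (nu i j))%MS.
    by case: (mnP (i, j)).
  have /(envelopeP H mu0' nu0' wE) eqs := wenv.
  suff E i j : mu i j = X mu0 i j /\ nu i j = Y nu0 j i.
    by move=> i j; have := wE i j; have [-> ->] := E i j.
  have base : mu m1 m2 = X mu0 m1 m2 /\ nu m1 m2 = Y nu0 m2 m1.
    rewrite Xm Ym; apply: (quadric_point_inj H).
    have /eqmxP wE' := wE m1 m2; have /eqmxP wm' := wm.
    by apply/eqmxP/(eqmx_trans _ wm')/eqmx_sym.
  have step1 k l : mu k l = X mu0 k l /\ nu k l = Y nu0 l k <->
      mu (k + 1) l = X mu0 (k + 1) l /\ nu (k + 1) l = Y nu0 l (k + 1).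
    have [_ x1 E _] := XP k l; have [_ _ _ N] := YP l k.
    have [T0 _] := lf_generic H k l.
    exact: edge_solution_unique T0 (lf_al H k l) x1 E N (eqs k l).1.
  have step2 k l : mu k l = X mu0 k l /\ nu k l = Y nu0 l k <->
      mu k (l + 1) = X mu0 k (l + 1) /\ nu k (l + 1) = Y nu0 (l + 1) k.
    have [_ y1 E _] := YP l k; have [_ _ _ N] := XP k l.
    have [_ T0] := lf_generic H k l.
    have := edge_solution_unique T0 (lf_alb H k l) y1 E N (eqs k l).2.
    by move=> [s1 s2]; split=> -[? ?]; [have [] := s1|have [] := s2].
  apply: (int_shift_ind (P := fun l =>
    mu i l = X mu0 i l /\ nu i l = Y nu0 l i) _ (step2 i)).
  exact: (int_shift_ind (P := fun k =>
    mu k m2 = X mu0 k m2 /\ nu k m2 = Y nu0 m2 k) base (step1^~ m2)).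
- apply/(@envelopeP _ _ _ _ (X mu0) (fun i j => Y nu0 j i) H) => //.
  + by move=> i j; case: (XP i j).
  + by move=> i j; case: (YP j i).
  + by move=> i j; rewrite submx_refl.
  + move=> i j; have [_ _ E1 N2] := XP i j; have [_ _ E2 N1] := YP j i.
    by split; split=> //; [rewrite [X in _ * X]N1|rewrite [X in _ * X]N2];
      rewrite mulr0.
Qed.

(** * Generators through the points of a quadric *)

(** The line mu = s1 / s0 of the quadric; the other ruling is obtained from the
    transposed frame. *)
Definition generator_line (R : realType) (F : frame R) (i j : int) (s0 s1 : R)
    : 'M[R]_(2, 4) :=
  \matrix_(k < 2)
    if k == 0 then comb F i j 0 s1 0 s0 else comb F i j s1 0 s0 0.

Lemma generator_lineE (R : realType) (F : frame R) i j (s0 s1 : R)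
    (D : 'rV[R]_2) :
  D *m generator_line F i j s0 s1 =
  comb F i j (D 0 1 * s1) (D 0 0 * s1) (D 0 1 * s0) (D 0 0 * s0).
Proof.
apply/rowP => l; rewrite !mxE big_ord_recl big_ord1.
have -> : lift 0 0 = 1 :> 'I_2 by apply/val_inj.
by rewrite /= /comb !mxE; ring.
Qed.

Lemma mem_generator_line (R : realType) (F : frame R) i j (s0 s1 t0 t1 : R) :
  (comb F i j (t1 * s1) (t0 * s1) (t1 * s0) (t0 * s0)
     <= generator_line F i j s0 s1)%MS.
Proof.
apply/submxP; exists (\row_k if k == 0 then t0 else t1).
by rewrite generator_lineE !mxE.
Qed.

Lemma generator_lineP (R : realType) (F : frame R) Q i j (s0 s1 : R) :
  lie_frame F Q -> (s0 != 0) || (s1 != 0) ->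
  generator (Q i j) (generator_line F i j s0 s1).
Proof.
move=> H s; split.
  apply: inj_row_free => D; rewrite generator_lineE => /(lf_free H).
  move=> [/eqP + /eqP + /eqP + /eqP]; rewrite !mulf_eq0.
  move=> d1 d0 d1' d0'.
  have D0 : D 0 0 = 0.
    by case/orP: s => /negPf s; move: d0 d0'; rewrite s ?orbF => /eqP // _ /eqP.
  have D1 : D 0 1 = 0.
    by case/orP: s => /negPf s; move: d1 d1'; rewrite s ?orbF => /eqP // _ /eqP.
  apply/rowP => k; rewrite mxE.
  by case: (unliftP 0 k) => [k'|] -> //; rewrite [k']ord1 -D1; congr (D _ _);
    apply/val_inj.
move=> p /submxP[D ->]; rewrite generator_lineE; apply/on_quadricE.
by have [c c0 ->] := lf_gram H i j; ring.
Qed.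

(** * The frame of a projective minimal surface *)

(** The four frame vectors span the same space as the vertices of the
    quadrilateral, which is not planar. *)
Lemma frame_free (R : realType) (x : net R) (F : frame R) i j x0 x1 x2 x3 :
  nonplanar_quadrilaterals x -> same_net (fr F) x ->
  (forall i j, fal F i j != 0 /\ falb F i j != 0) ->
  comb F i j x0 x1 x2 x3 = 0 -> [/\ x0 = 0, x1 = 0, x2 = 0 & x3 = 0].
Proof.
move=> planar xE al0.
pose B := \matrix_(k < 4)
  nth 0 [:: fr F i j; fr1 F i j; fr2 F i j; fr12 F i j] k.
pose D := \row_(k < 4) nth 0 [:: x0; x1; x2; x3] k.
have DB : D *m B = comb F i j x0 x1 x2 x3.
  by apply/rowP => l; rewrite !mxE !big_ord_recl big_ord0 !mxE /=; ring.
have Brow n y c : c *: y = row n B -> c != 0 -> (y <= B)%MS.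
  by move=> yE c0; rewrite -(scalerK c0 y) yE scalemx_sub // row_sub.
have rowB n : row n B =
    nth 0 [:: fr F i j; fr1 F i j; fr2 F i j; fr12 F i j] n.
  by apply/rowP => l; rewrite !mxE.
have Bfree : row_free B.
  suff /mxrankS : (x i j + sh1 x i j + sh2 x i j + sh1 (sh2 x) i j <= B)%MS.
    by rewrite planar /row_free eqn_leq rank_leq_row.
  rewrite !addsmx_sub.
  have sub k l : (x k l <= fr F k l)%MS by case/andP: (xE k l).
  rewrite /sh1 /sh2 !(submx_trans (sub _ _)) //.
  - by apply: (@Brow 3 _ (fal F i j * falb F (i + 1) j)); rewrite ?rowB //
      mulf_neq0 //; [case: (al0 i j)|case: (al0 (i + 1) j)].
  - by apply: (@Brow 2 _ (falb F i j)); rewrite ?rowB //; case: (al0 i j).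
  - by apply: (@Brow 1 _ (fal F i j)); rewrite ?rowB //; case: (al0 i j).
  - by apply: (@Brow 0 _ 1); rewrite ?rowB ?scale1r ?oner_eq0.
move=> E; have /eqP := DB; rewrite E mulmx_free_eq0 // => /eqP D0.
have Dk k : D 0 k = 0 by rewrite D0 mxE.
by split; [have := Dk 0|have := Dk 1|have := Dk 2|have := Dk 3]; rewrite mxE.
Qed.

(** Evaluating the quadratic form at points with parameters 0, 1 or infinity
    leaves only the products of r with r^12 and of r^1 with r^2, and makes these
    two opposite. *)
Lemma gram_of_parametrisation (R : realType) (F : frame R) (Q : lattice 'M[R]_4)
    i j :
  (forall x0 x1 x2 x3, comb F i j x0 x1 x2 x3 = 0 ->
     [/\ x0 = 0, x1 = 0, x2 = 0 & x3 = 0]) ->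
  (Q i j)^T = Q i j -> parametrises F Q ->
  exists2 c : R, c != 0 & forall x0 x1 x2 x3 y0 y1 y2 y3,
    bil (Q i j) (comb F i j x0 x1 x2 x3) (comb F i j y0 y1 y2 y3)
    = c * (x0 * y3 + x3 * y0 - x1 * y2 - x2 * y1).
Proof.
move=> free QT par.
pose b := bil (Q i j).
have bC x y : b x y = b y x by exact: bilC.
set r := fr F i j; set r1 := fr1 F i j; set r2 := fr2 F i j.
set r12 := fr12 F i j.
have expand x0 x1 x2 x3 y0 y1 y2 y3 :
    b (comb F i j x0 x1 x2 x3) (comb F i j y0 y1 y2 y3)
    = x0 * y0 * b r r + x1 * y1 * b r1 r1 + x2 * y2 * b r2 r2
      + x3 * y3 * b r12 r12
      + (x0 * y1 + x1 * y0) * b r r1 + (x0 * y2 + x2 * y0) * b r r2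
      + (x1 * y3 + x3 * y1) * b r1 r12 + (x2 * y3 + x3 * y2) * b r2 r12
      + (x0 * y3 + x3 * y0) * b r r12 + (x1 * y2 + x2 * y1) * b r1 r2.
  rewrite /comb -/r -/r1 -/r2 -/r12; clearbody r r1 r2 r12.
  rewrite /b !(bilDl, bilDr, bilZl, bilZr) -/b.
  rewrite (bC r12 r) (bC r12 r1) (bC r12 r2) (bC r1 r) (bC r2 r) (bC r2 r1).
  by ring.
have on m0 m1 k0 k1 (p := comb F i j (m1 * k1) (m1 * k0) (m0 * k1) (m0 * k0)) :
    b p p = 0.
  by apply/on_quadricE/par; exists m0, m1, k0, k1.
have h m0 m1 k0 k1 := on m0 m1 k0 k1; move: h => {on} h.
have v12 : b r12 r12 = 0.
  by rewrite -[RHS](h 1 0 1 0) expand; ring.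
have v1 : b r1 r1 = 0 by rewrite -[RHS](h 0 1 1 0) expand; ring.
have v2 : b r2 r2 = 0 by rewrite -[RHS](h 1 0 0 1) expand; ring.
have v0 : b r r = 0 by rewrite -[RHS](h 0 1 0 1) expand; ring.
have half (x : R) : x + x = 0 -> x = 0.
  by move=> /eqP; rewrite -mulr2n mulrn_eq0 => /eqP.
have e1_12 : b r1 r12 = 0.
  by apply: half; rewrite -[RHS](h 1 1 1 0) expand v12 v1; ring.
have e2_12 : b r2 r12 = 0.
  by apply: half; rewrite -[RHS](h 1 0 1 1) expand v12 v2; ring.
have e0_1 : b r r1 = 0.
  by apply: half; rewrite -[RHS](h 0 1 1 1) expand v0 v1; ring.
have e0_2 : b r r2 = 0.
  by apply: half; rewrite -[RHS](h 1 1 0 1) expand v0 v2; ring.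
have d12 : b r1 r2 = - b r r12.
  apply/eqP; rewrite -addr_eq0; apply/eqP/half.
  rewrite -[RHS](h 1 1 1 1) expand v0 v1 v2 v12 e1_12 e2_12 e0_1 e0_2; ring.
have gram x0 x1 x2 x3 y0 y1 y2 y3 :
    b (comb F i j x0 x1 x2 x3) (comb F i j y0 y1 y2 y3)
    = b r r12 * (x0 * y3 + x3 * y0 - x1 * y2 - x2 * y1).
  by rewrite expand v0 v1 v2 v12 e1_12 e2_12 e0_1 e0_2 d12; ring.
exists (b r r12) => //; apply/eqP => c0.
(* Otherwise the form vanishes on r + r^12, whose coordinates do not satisfy
   x0 x12 = x1 x2. *)
have : on_quadric (Q i j) (comb F i j 1 0 0 1).
  by apply/on_quadricE; rewrite -/b gram c0 mul0r.
case/par => m0 [m1 [k0 [k1 E]]].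
have /free[e0 e1 e2 e3] : comb F i j (1 - m1 * k1) (0 - m1 * k0) (0 - m0 * k1)
    (1 - m0 * k0) = 0.
  move/eqP: E; rewrite -subr_eq0 => /eqP <-.
  by apply/rowP => l; rewrite !mxE; ring.
suff : (1 : R) = 0 by apply/eqP; rewrite oner_eq0.
transitivity ((m1 * k1) * (m0 * k0)).
  by rewrite -(subr0_eq e0) -(subr0_eq e3) mulr1.
transitivity ((m1 * k0) * (m0 * k1)); first by ring.
by rewrite -(subr0_eq e1) mul0r.
Qed.

Lemma lie_frame_of_surface (R : realType) (x : net R) (Q : lattice 'M[R]_4)
    (F : frame R) :
  generic_projective_minimal_surface x Q F -> lie_frame F Q.
Proof.
case=> -[_ planar] [assoc _ _] [xE al0 closed par [eq1 eq2]] coef [mi gen].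
have free i j x0 x1 x2 x3 :=
  @frame_free R x F i j x0 x1 x2 x3 planar xE al0.
split=> //.
- by move=> i j; case: (al0 i j).
- by move=> i j; case: (al0 i j).
- by move=> i j; case: (assoc i j) => -[].
- move=> i j; case: (assoc i j) => -[QT _] _.
  exact: gram_of_parametrisation (free i j) QT par.
Qed.

(** * Envelopes through generic points *)

(** The points with an infinite parameter mu or nu fill one generator each. *)
Lemma quadric_point_cases (R : realType) (F : frame R) Q i j (p : 'rV[R]_4) :
  lie_frame F Q -> parametrises F Q -> on_quadric (Q i j) p -> p != 0 ->
  [\/ (p <= generator_line F i j 0 1)%MS,
      (p <= generator_line (transpose_frame F) j i 0 1)%MS |
      exists mu nu, (p == quadric_point F i j mu nu)%MS].
Proof.
move=> H par /par[m0 [m1 [k0 [k1 pE]]]] p0.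
have {}pE : p = comb F i j (m1 * k1) (m1 * k0) (m0 * k1) (m0 * k0) by [].
have [m00|m00] := eqVneq m0 0.
  constructor 1; rewrite pE m00.
  by have := mem_generator_line F i j 0 1 (m1 * k0) (m1 * k1);
    rewrite !mulr1 !mulr0 !mul0r.
have [k00|k00] := eqVneq k0 0.
  constructor 2; rewrite pE k00 -comb_transpose; last exact: lf_closed H.
  by have := mem_generator_line (transpose_frame F) j i 0 1 (m0 * k1) (m1 * k1);
    rewrite !mulr1 !mulr0.
constructor 3; exists (m1 / m0), (k1 / k0).
have -> : p = (m0 * k0) *: quadric_point F i j (m1 / m0) (k1 / k0).
  rewrite pE quadric_pointE; apply/rowP => l; rewrite !mxE.
  by field; rewrite m00 k00.
by apply/eqmxP/eqmx_scale; rewrite mulf_neq0.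
Qed.

Lemma quadric_point_generator1 (R : realType) (F : frame R) i j (mu nu : R) :
  (quadric_point F i j mu nu <= generator_line F i j 1 mu)%MS.
Proof.
by have := mem_generator_line F i j 1 mu 1 nu;
  rewrite quadric_pointE !mulr1 mul1r mulrC.
Qed.

Lemma quadric_point_generator2 (R : realType) (F : frame R) Q i j (mu nu : R) :
  lie_frame F Q ->
  (quadric_point F i j mu nu <= generator_line (transpose_frame F) j i 1 nu)%MS.
Proof.
by move=> H; rewrite -(quadric_point_transpose _ _ _ _ H)
  quadric_point_generator1.
Qed.

Theorem theorem5p4 (R : realType) (Sigma : net R) (Q : lattice 'M[R]_4)
    (F : frame R) (HSigma : generic_projective_minimal_surface Sigma Q F)
    (m1 m2 : int) :
  two_parameter_family_of_envelopes Q F m1 m2 /\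
  holds_at_generic_point (Q m1 m2) (unique_envelope_through Q F m1 m2).
Proof.
have H := lie_frame_of_surface HSigma.
have [e [f [W WP]]] := unique_envelopes m1 m2 H.
split.
  exists (range e), (range f); split.
  - exact: sub_countable (card_image_le _ _) (countableP _).
  - exact: sub_countable (card_image_le _ _) (countableP _).
  have good (h : nat -> R) x : ~ range h x -> forall n, h n <> x.
    by move=> hx n hn; apply: hx; exists n.
  exists W; split=> [mu nu /good emu /good fnu|].
    have [env -> _] := WP mu nu emu fnu; split=> //.
    by rewrite submx_refl.
  move=> mu nu mu' nu' /good emu /good fnu /good emu' /good fnu' same.
  apply: (quadric_point_inj (i := m1) (j := m2) H).
  have [_ <- _] := WP mu nu emu fnu; have [_ <- _] := WP mu' nu' emu' fnu'.
  exact: same.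
have par : parametrises F Q by case: HSigma => _ _ [].
(* The boolean chooses the ruling; None stands for the parameter infinity. *)
pose G (n : nat) : 'M[R]_(2, 4) :=
  match unpickle n : option (bool * option nat) with
  | Some (false, Some l) => generator_line F m1 m2 1 (e l)
  | Some (true, Some l) => generator_line (transpose_frame F) m2 m1 1 (f l)
  | Some (true, None) => generator_line (transpose_frame F) m2 m1 0 1
  | _ => generator_line F m1 m2 0 1
  end.
exists G; split=> [n|p p0 pQ pG].
  have gen s0 s1 := @generator_lineP _ F Q m1 m2 s0 s1 H.
  have gent s0 s1 :=
    @generator_lineP _ _ _ m2 m1 s0 s1 (lie_frame_transpose H).
  rewrite /G; case: unpickle => [[[] [l|]]|].
  - by apply: gent; rewrite oner_eq0.
  - by apply: gent; rewrite oner_eq0 orbT.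
  - by apply: gen; rewrite oner_eq0.
  - by apply: gen; rewrite oner_eq0 orbT.
  - by apply: gen; rewrite oner_eq0 orbT.
have notG t : ~~ (p <= G (pickle (t : bool * option nat)))%MS by exact: pG.
have [pg|pg|[mu [nu pE]]] := quadric_point_cases H par pQ p0.
- by have := notG (false, None); rewrite /G pickleK pg.
- by have := notG (true, None); rewrite /G pickleK pg.
have /eqmxP pE' := pE.
have emu n : e n <> mu.
  move=> en; have := notG (false, Some n).
  by rewrite /G pickleK en pE' quadric_point_generator1.
have fnu n : f n <> nu.
  move=> fn; have := notG (true, Some n).
  by rewrite /G pickleK fn pE' (quadric_point_generator2 _ _ _ _ H).
have [env Wm uniq] := WP mu nu emu fnu.
exists (W mu nu); split=> //; first by rewrite Wm; apply/eqmxP/eqmx_sym.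
move=> w wenv /eqmxP wp; apply: uniq => //.
exact/eqmxP/(eqmx_trans wp).
Qed.
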